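(* Let $\{X_i\}_{i\in J}$ be a family of real or complex Banach spaces. Let $(x_i)\in \left(\bigoplus_{i\in J}X_i\right)_{c_0}$ be such that $\|(x_i)\|=1$ and let $\Lambda=\{i\in J:\|x_i\|=1\}$. Then $S_{(x_i)}$ is norm compact if and only if $S_{x_i}$ is norm compact for each $i\in\Lambda$.
   Context: $\left(\bigoplus_{i\in J}X_i\right)_{c_0}$ is the $c_0$-direct sum: the space of families $(x_i)_{i\in J}$ with $x_i\in X_i$ and $\|x_i\|\to 0$ (i.e. for every $\epsilon>0$ the set $\{i:\|x_i\|\ge\epsilon\}$ is finite), with norm $\|(x_i)\|=\sup_{i\in J}\|x_i\|$. For a Banach space $E$ with unit sphere $S(E)$ and $e\in S(E)$, the state space of $e$ is $S_e=\{e^*\in S(E^* ):e^*(e)=1\}\subseteq E^*$; $S_{(x_i)}$ is taken with $E$ the $c_0$-direct sum and $S_{x_i}$ with $E=X_i$. Norm compact means compact in the norm topology of the corresponding dual space. *)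

(* Defs.v *)
From HB Require Import structures.
From mathcomp Require Import all_boot all_order all_algebra.
From mathcomp Require Import complex.
From mathcomp Require Import boolp classical_sets functions cardinality reals.
From mathcomp Require Import topology normedtype.

Set Implicit Arguments.
Unset Strict Implicit.
Unset Printing Implicit Defensive.

Import Order.TTheory GRing.Theory Num.Theory.
Import numFieldNormedType.Exports.

Local Open Scope classical_set_scope.
Local Open Scope ring_scope.

Inductive scalar_kind := real_scalars | complex_scalars.

Definition scalars (R : realType) (k : scalar_kind) : numFieldType :=
  match k with
  | real_scalars => R
  | complex_scalars => R[i]
  end.

(* Norms in a [normedModType K] are valued in [K] itself. For [K = R[i]] they
   lie on the nonnegative real axis, and [x <= y] on [R[i]] means
   [Im x = Im y] and [Re x <= Re y]; hence the least upper bound in [R[i]] of a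
   nonempty bounded set of norms is the usual supremum of real numbers. The
   default value [0] is that of the supremum of an empty set of norms. *)
Definition sup_norm (K : numFieldType) (A : set K) : K := supremum 0 A.

Section sup_norm.
Context (R : realType) (k : scalar_kind).
Local Notation K := (scalars R k).
Implicit Types A : set K.

Lemma scalars_supremums A : A `<=` [set a | 0 <= a] -> A !=set0 ->
  ubound A !=set0 -> supremums A !=set0.
Proof.
case: k A => /= A A0 [a Aa] [u Au].
  have hA : has_sup A by split; [exists a | exists u].
  exists (sup A); split; first exact: (sup_upper_bound hA).
  by move=> v Av; apply: ge_sup => //; exists a.
have ImA b : A b -> complex.Im b = 0.
  by move=> /A0; rewrite /= lecE => /andP[/eqP].
pose B : set R := @complex.Re R @` A.
have hB : has_sup B.
  split; first by exists (complex.Re a), a.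
  exists (complex.Re u) => _ [b Ab <-].
  by have := Au _ Ab; rewrite lecE => /andP[].
exists (Complex (sup B) 0); split.
  move=> b Ab; rewrite lecE /= ImA// eqxx /=.
  by apply: (ub_le_sup hB.2); exists b.
move=> v Av; rewrite lecE /=.
have := Av _ Aa; rewrite lecE (ImA a) // => /andP[-> _] /=.
apply: (ge_sup hB.1) => _ [b Ab <-].
by have := Av _ Ab; rewrite lecE => /andP[].
Qed.

Lemma sup_normP A : A `<=` [set a | 0 <= a] -> A !=set0 ->
  ubound A !=set0 -> supremums A (sup_norm A).
Proof.
move=> A0 Ane uA; rewrite /sup_norm /supremum; case: ifPn => [/eqP AE|_].
  by case: Ane => a; rewrite AE.
by apply: xgetPex; exact: scalars_supremums.
Qed.

Lemma sup_norm_ub A a : A `<=` [set b | 0 <= b] -> ubound A !=set0 ->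
  A a -> a <= sup_norm A.
Proof.
move=> A0 uA Aa; have Ane : A !=set0 by exists a.
exact: (sup_normP A0 Ane uA).1.
Qed.

Lemma sup_norm_le A M : A `<=` [set b | 0 <= b] -> 0 <= M ->
  ubound A M -> sup_norm A <= M.
Proof.
move=> A0 M0 AM; have [->|/set0P Ane] := eqVneq A set0.
  by rewrite /sup_norm supremum0.
exact: (sup_normP A0 Ane (ex_intro _ M AM)).2.
Qed.

Lemma sup_norm_ge0 A : A `<=` [set b | 0 <= b] -> ubound A !=set0 ->
  0 <= sup_norm A.
Proof.
move=> A0 uA; have [->|/set0P[a Aa]] := eqVneq A set0.
  by rewrite /sup_norm supremum0.
exact: le_trans (A0 _ Aa) (sup_norm_ub A0 uA Aa).
Qed.

End sup_norm.

Section c0_sum.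
Context (R : realType) (k : scalar_kind) (J : Type).
Local Notation K := (scalars R k).
Context (X : J -> completeNormedModType K).

Definition vanishing (x : forall i, X i) :=
  forall eps : K, 0 < eps -> finite_set [set i | eps <= `|x i|].

Record c0_sum := C0Sum {
  c0_fun :> forall i, X i ;
  c0_vanishing : vanishing c0_fun }.

HB.instance Definition _ := gen_eqMixin c0_sum.
HB.instance Definition _ := gen_choiceMixin c0_sum.

Lemma c0_sum_eq (x y : c0_sum) : (forall i, x i = y i) -> x = y.
Proof.
case: x y => [x hx] [y hy] /= xy.
have {xy} : x = y by exact: functional_extensionality_dep.
by move=> xy; rewrite {}xy in hx *; congr C0Sum; exact: Prop_irrelevance.
Qed.

Lemma vanishing0 : vanishing (fun=> 0).
Proof.
move=> e e0; rewrite (_ : mkset _ = set0) //; apply/seteqP; split => // i /=.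
by rewrite normr0 lt_geF.
Qed.

Lemma vanishingN x : vanishing x -> vanishing (fun i => - x i).
Proof. by move=> hx e /hx; under eq_set do rewrite -normrN. Qed.

Lemma vanishingD x y :
  vanishing x -> vanishing y -> vanishing (fun i => x i + y i).
Proof.
move=> hx hy e e0; have e20 : 0 < e / 2 by rewrite divr_gt0.
apply: (@sub_finite_set _ _ ([set i | e / 2 <= `|x i|] `|`
                             [set i | e / 2 <= `|y i|])).
  move=> i /= exy.
  have [|xe] := real_leP (gtr0_real e20) (normr_real (x i)); first by left.
  have [|ye] := real_leP (gtr0_real e20) (normr_real (y i)); first by right.
  by have := le_lt_trans (le_trans exy (ler_normD _ _)) (ltrD xe ye);
     rewrite -splitr ltxx.
by rewrite finite_setU; split; [exact: hx | exact: hy].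
Qed.

Lemma vanishingZ (l : K) x : vanishing x -> vanishing (fun i => l *: x i).
Proof.
move=> hx; have [->|l0] := eqVneq l 0.
  by move=> e /vanishing0; under eq_set do rewrite -(scale0r (x _)).
move=> e e0; have nl0 : 0 < `|l| by rewrite normr_gt0.
have := hx (e / `|l|) (divr_gt0 e0 nl0).
by under eq_set do rewrite ler_pdivrMr // mulrC -normrZ.
Qed.

Let zero := C0Sum vanishing0.
Let opp (x : c0_sum) := C0Sum (vanishingN (c0_vanishing x)).
Let add (x y : c0_sum) := C0Sum (vanishingD (c0_vanishing x) (c0_vanishing y)).
Let scale (l : K) (x : c0_sum) := C0Sum (vanishingZ l (c0_vanishing x)).

Let addA : associative add.
Proof. by move=> x y z; apply: c0_sum_eq => i; exact: addrA. Qed.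
Let addC : commutative add.
Proof. by move=> x y; apply: c0_sum_eq => i; exact: addrC. Qed.
Let add0 : left_id zero add.
Proof. by move=> x; apply: c0_sum_eq => i; exact: add0r. Qed.
Let addN : left_inverse zero opp add.
Proof. by move=> x; apply: c0_sum_eq => i; exact: addNr. Qed.

HB.instance Definition _ := GRing.isZmodule.Build c0_sum addA addC add0 addN.

Let scaleA a b (x : c0_sum) : scale a (scale b x) = scale (a * b) x.
Proof. by apply: c0_sum_eq => i; exact: scalerA. Qed.
Let scale1 : left_id 1 scale.
Proof. by move=> x; apply: c0_sum_eq => i; exact: scale1r. Qed.
Let scaleDr : right_distributive scale +%R.
Proof. by move=> a x y; apply: c0_sum_eq => i; exact: scalerDr. Qed.
Let scaleDl (x : c0_sum) : {morph scale^~ x : a b / a + b}.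
Proof. by move=> a b; apply: c0_sum_eq => i; exact: scalerDl. Qed.

HB.instance Definition _ :=
  GRing.Zmodule_isLmodule.Build K c0_sum scaleA scale1 scaleDr scaleDl.

Lemma c0_sumD (x y : c0_sum) i : (x + y) i = x i + y i. Proof. by []. Qed.
Lemma c0_sumZ l (x : c0_sum) i : (l *: x) i = l *: x i. Proof. by []. Qed.

Definition c0_norm (x : c0_sum) : K := sup_norm [set `|x i| | i in [set: J]].

Lemma c0_norm_nneg (x : c0_sum) :
  [set `|x i| | i in [set: J]] `<=` [set b : K | 0 <= b].
Proof. by move=> _ [i _ <-] /=. Qed.

Lemma c0_norm_bounded (x : c0_sum) :
  ubound [set `|x i| | i in [set: J]] !=set0.
Proof.
have /(finite_image (fun i => `|x i|))/finite_seqP[s sE] :=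
  c0_vanishing x ltr01.
have s0 : 0 <= \sum_(a <- s) `|a| by exact: sumr_ge0.
exists (1 + \sum_(a <- s) `|a|) => _ [i _ <-].
have [xi|/ltW xi] := real_leP (real1 _) (normr_real (x i)); last first.
  by rewrite (le_trans xi) // lerDl.
have : `|x i| \in s.
  by have : [set` s] `|x i| by rewrite -sE; exists i.
move=> /perm_to_rem xs; rewrite (perm_big _ xs) /= big_cons normr_id.
rewrite addrCA lerDl addr_ge0 // sumr_ge0 // => *; exact: normr_ge0.
Qed.

Lemma c0_norm_ub (x : c0_sum) i : `|x i| <= c0_norm x.
Proof.
by apply: sup_norm_ub; [exact: c0_norm_nneg | exact: c0_norm_bounded | exists i].
Qed.

Lemma c0_norm_le (x : c0_sum) M :
  0 <= M -> (forall i, `|x i| <= M) -> c0_norm x <= M.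
Proof.
by move=> M0 xM; apply: sup_norm_le => // [|_ [i _ <-]//]; exact: c0_norm_nneg.
Qed.

Lemma c0_norm_ge0 (x : c0_sum) : 0 <= c0_norm x.
Proof.
by apply: sup_norm_ge0; [exact: c0_norm_nneg | exact: c0_norm_bounded].
Qed.

Let norm_triangle (x y : c0_sum) : c0_norm (x + y) <= c0_norm x + c0_norm y.
Proof.
apply: c0_norm_le => [|i]; first by rewrite addr_ge0 // c0_norm_ge0.
by rewrite c0_sumD (le_trans (ler_normD _ _)) // lerD // c0_norm_ub.
Qed.

Let norm_eq0 (x : c0_sum) : c0_norm x = 0 -> x = 0.
Proof.
move=> x0; apply: c0_sum_eq => i; apply/normr0_eq0/eqP.
by rewrite eq_le normr_ge0 andbT -x0 c0_norm_ub.
Qed.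

Let normZ_le l (x : c0_sum) : c0_norm (l *: x) <= `|l| * c0_norm x.
Proof.
apply: c0_norm_le => [|i]; first by rewrite mulr_ge0 // c0_norm_ge0.
by rewrite c0_sumZ normrZ ler_wpM2l // c0_norm_ub.
Qed.

Let normZ l (x : c0_sum) : c0_norm (l *: x) = `|l| * c0_norm x.
Proof.
apply/eqP; rewrite eq_le normZ_le /=.
have [->|l0] := eqVneq l 0; first by rewrite normr0 mul0r c0_norm_ge0.
rewrite -ler_pdivlMl ?normr_gt0 // -normfV.
by rewrite (le_trans _ (normZ_le _ _)) // scalerK.
Qed.

HB.instance Definition _ :=
  Lmodule_isNormed.Build K c0_sum norm_triangle normZ norm_eq0.

Lemma c0_normE (x : c0_sum) : `|x| = c0_norm x. Proof. by []. Qed.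

End c0_sum.

Section dual.
Context (R : realType) (k : scalar_kind).
Local Notation K := (scalars R k).
Context (E : normedModType K).

Definition dual_pred : {pred E -> K^o} :=
  mem [set f : E -> K^o | linear f /\ continuous f].

Record dual := Dual {
  dual_fun :> E -> K^o ;
  dual_subproof : dual_fun \in dual_pred }.

HB.instance Definition _ := [isSub of dual for dual_fun].
HB.instance Definition _ := [Choice of dual by <:].

Lemma dual_submod_closed : submod_closed dual_pred.
Proof.
split.
  rewrite inE; split; last by move=> x; exact: cvg_cst.
  by move=> a x y; rewrite scaler0 addr0.
move=> a f g /[!inE] -[lf cf] [lg cg]; split.
  have afgE z : (a *: f + g) z = a * f z + g z by [].
  move=> b x y; rewrite !afgE lf lg.
  by rewrite /GRing.scale /= !mulrDr addrACA mulrCA.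
by move=> x; apply: cvgD; [apply: cvgZr; exact: cf | exact: cg].
Qed.

HB.instance Definition _ :=
  GRing.isSubmodClosed.Build _ _ dual_pred dual_submod_closed.
HB.instance Definition _ := [SubChoice_isSubLmodule of dual by <:].

Lemma dual_linear (f : dual) : linear f.
Proof. by have := dual_subproof f; rewrite inE => -[]. Qed.

HB.instance Definition _ (f : dual) :=
  GRing.isLinear.Build K E K^o *:%R (dual_fun f) (dual_linear f).

Lemma dual_continuous (f : dual) : continuous f.
Proof. by have := dual_subproof f; rewrite inE => -[]. Qed.

Lemma dual_eq (f g : dual) : (forall x, f x = g x) -> f = g.
Proof. by move=> fg; apply: val_inj; exact: funext. Qed.

Lemma dualD (f g : dual) x : (f + g) x = f x + g x. Proof. by []. Qed.
Lemma dualZ a (f : dual) x : (a *: f) x = a * f x. Proof. by []. Qed.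

Definition dual_norm (f : dual) : K :=
  sup_norm [set `|f x : K| | x in [set x : E | `|x| <= 1]].

Lemma dual_norm_nneg (f : dual) :
  [set `|f x : K| | x in [set x : E | `|x| <= 1]] `<=` [set b : K | 0 <= b].
Proof. by move=> _ [x _ <-] /=. Qed.

Lemma dual_norm_bounded (f : dual) :
  ubound [set `|f x : K| | x in [set x : E | `|x| <= 1]] !=set0.
Proof.
have /linear_bounded_continuous/bounded_funP/(_ 1)[M fM] :
  continuous (f : {linear E -> K^o}) by exact: dual_continuous.
by exists M => _ [x /= x1 <-]; exact: fM.
Qed.

Lemma dual_norm_ub1 (f : dual) x : `|x| <= 1 -> `|f x : K| <= dual_norm f.
Proof.
move=> x1; apply: sup_norm_ub; [exact: dual_norm_nneg | | by exists x].
exact: dual_norm_bounded.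
Qed.

Lemma dual_norm_le (f : dual) M : 0 <= M ->
  (forall x, `|x| <= 1 -> `|f x : K| <= M) -> dual_norm f <= M.
Proof.
move=> M0 fM; apply: sup_norm_le => // [|_ [x x1 <-]]; last exact: fM.
exact: dual_norm_nneg.
Qed.

Lemma dual_norm_ge0 (f : dual) : 0 <= dual_norm f.
Proof.
by apply: sup_norm_ge0; [exact: dual_norm_nneg | exact: dual_norm_bounded].
Qed.

Lemma dual_norm_ub (f : dual) x : `|f x : K| <= dual_norm f * `|x|.
Proof.
have [->|x0] := eqVneq x 0; first by rewrite linear0 !normr0 mulr0.
have nx0 : 0 < `|x| by rewrite normr_gt0.
have := @dual_norm_ub1 f (`|x|^-1 *: x).
rewrite normfZV // lexx => /(_ isT).
rewrite linearZ /= normrM normfV normr_id.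
by rewrite ler_pdivrMl // mulrC.
Qed.

Let norm_triangle (f g : dual) : dual_norm (f + g) <= dual_norm f + dual_norm g.
Proof.
apply: dual_norm_le => [|x x1]; first by rewrite addr_ge0 // dual_norm_ge0.
by rewrite dualD (le_trans (ler_normD _ _)) // lerD // dual_norm_ub1.
Qed.

Let norm_eq0 (f : dual) : dual_norm f = 0 -> f = 0.
Proof.
move=> f0; apply: dual_eq => x; apply/normr0_eq0/eqP.
by rewrite eq_le normr_ge0 andbT -(mul0r `|x|) -f0 dual_norm_ub.
Qed.

Let normZ_le l (f : dual) : dual_norm (l *: f) <= `|l| * dual_norm f.
Proof.
apply: dual_norm_le => [|x x1]; first by rewrite mulr_ge0 // dual_norm_ge0.
by rewrite dualZ normrM ler_wpM2l // dual_norm_ub1.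
Qed.

Let normZ l (f : dual) : dual_norm (l *: f) = `|l| * dual_norm f.
Proof.
apply/eqP; rewrite eq_le normZ_le /=.
have [->|l0] := eqVneq l 0; first by rewrite normr0 mul0r dual_norm_ge0.
rewrite -ler_pdivlMl ?normr_gt0 // -normfV.
by rewrite (le_trans _ (normZ_le _ _)) // scalerK.
Qed.

HB.instance Definition _ :=
  Lmodule_isNormed.Build K dual norm_triangle normZ norm_eq0.

Lemma dual_normE (f : dual) : `|f| = dual_norm f. Proof. by []. Qed.

Definition state_space (e : E) : set dual :=
  [set f : dual | `|f| = 1 /\ f e = 1].

End dual.

(* Main.v *)
(* Write P_i for composition with the i-th coordinate and R_i for restriction to
   the i-th summand; both are nonexpansive and R_i P_i = id. If S_x is compact,
   so is its closed subset of fixed points of P_i R_i, whose image under R_i is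
   S_{x_i}. Conversely, Lambda is finite and the other coordinates of x are
   bounded away from 1, so f in S_x vanishes on elements supported off Lambda
   and f = \sum_(i in Lambda) P_i (R_i f). Replacing the i-th coordinate of x by
   t u with |t|, |u| <= 1 gives |1 - a| + |(R_i f) u| <= 1 where a = (R_i f)(x_i),
   hence |R_i f| <= |a|: R_i f is 0 or a multiple a g with g in S_{x_i} and
   |a| <= 1. Thus S_x is a closed subset of a finite sum of compact sets. *)
Require Import Defs.
From mathcomp Require Import all_boot all_order all_algebra complex.
From mathcomp Require Import boolp cardinality.
From mathcomp Require Import classical_sets reals topology normedtype.

Set Implicit Arguments.
Unset Strict Implicit.
Unset Printing Implicit Defensive.

Import Order.TTheory GRing.Theory Num.Theory.
Import numFieldNormedType.Exports.

Local Open Scope classical_set_scope.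
Local Open Scope ring_scope.

(** * Closed and compact sets in normed spaces, and two estimates on scalars *)

Section normed.
Context (K : numFieldType).

Lemma lipschitz_continuous (V W : normedModType K) (M : K) (f : V -> W) :
  0 < M -> (forall x y, `|f x - f y| <= M * `|x - y|) -> continuous f.
Proof.
move=> M0 fle x; apply/cvgrPdist_lt => e e0.
near=> y; apply: le_lt_trans (fle _ _) _.
rewrite -ltr_pdivlMl // mulrC; near: y.
by apply: cvgr_dist_lt => //; exact: divr_gt0.
Unshelve. all: by end_near. Qed.

Lemma normed_closed_set1 (V : normedModType K) (v : V) : closed [set v].
Proof. exact/accessible_closed_set1/hausdorff_accessible/norm_hausdorff. Qed.

Lemma closed_fixed_points (V : normedModType K) (f : V -> V) :
  continuous f -> closed [set v | f v = v].
Proof.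
move=> cf; have -> : [set v | f v = v] = (fun v => f v - v) @^-1` [set 0].
  by apply/seteqP; split => v /= => [->|/subr0_eq]; rewrite ?subrr.
apply: preimage_closed; last exact: normed_closed_set1.
by move=> v _; apply: cvgB; [exact: cf | exact: cvg_id].
Qed.

Lemma compact_add (V : normedModType K) (A B : set V) :
  compact A -> compact B -> compact [set p.1 + p.2 | p in A `*` B].
Proof.
move=> cA cB; apply: continuous_compact; last exact: compact_setX.
by apply: continuous_subspaceT; exact: add_continuous.
Qed.

Lemma compact_scale (V : normedModType K) (D : set K^o) (A : set V) :
  compact D -> compact A -> compact [set p.1 *: p.2 | p in D `*` A].
Proof.
move=> cD cA; apply: continuous_compact; last exact: compact_setX.
by apply: continuous_subspaceT; exact: scale_continuous.
Qed.

(** [B] is the iterated Minkowski sum of the [A i], starting from [[set 0]]. *)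
Lemma compact_sum_cover (V : normedModType K) (I : eqType) (s : seq I)
    (A : I -> set V) : (forall i, i \in s -> compact (A i)) ->
  exists B, compact B /\
    forall g, (forall i, i \in s -> A i (g i)) -> B (\sum_(i <- s) g i).
Proof.
elim: s => [|i s IH] cA.
  by exists [set 0]; split=> [|g _]; [exact: compact_set1 | rewrite big_nil].
have [|B [cB sB]] := IH; first by move=> j js; apply: cA; rewrite inE js orbT.
exists [set p.1 + p.2 | p in A i `*` B]; split.
  by apply: compact_add => //; apply: cA; rewrite mem_head.
move=> g gA; rewrite big_cons; exists (g i, \sum_(j <- s) g j) => //.
split=> /=; first by apply: gA; rewrite mem_head.
by apply: sB => j js; apply: gA; rewrite inE js orbT.
Qed.

(* The rotation by [t] aligns the phases of [c] and [d]. *)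
Lemma norm_add_aligned (c d : K) :
  exists2 t : K, `|t| <= 1 & `|c + t * d| = `|c| + `|d|.
Proof.
have [->|d0] := eqVneq d 0; first by exists 0; rewrite ?normr0 ?mulr0 ?addr0.
have [->|c0] := eqVneq c 0.
  by exists 1; rewrite ?normr1 // mul1r add0r normr0 add0r.
exists (c / `|c| * (`|d| / d)).
  by rewrite !normrM !normfV !normr_id !divff ?mulr1 ?normr_eq0.
have -> : c + c / `|c| * (`|d| / d) * d = c / `|c| * (`|c| + `|d|).
  by rewrite -mulrA divfK // mulrDr divfK // normr_eq0.
rewrite normrM normf_div normr_id divff ?normr_eq0 // mul1r.
by rewrite ger0_norm ?addr_ge0.
Qed.

(** [e] is the minimum of 1 and the positive gaps [1 - a]. Since the order of [K] may be partial,
    nonnegativity of the entries is what makes these gaps comparable. *)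
Lemma gap_below1 (s : seq K) : (forall a, a \in s -> 0 <= a) ->
  exists2 e : K, 0 < e <= 1 & forall a, a \in s -> a < 1 -> a <= 1 - e.
Proof.
elim: s => [|a s IH] s0; first by exists 1 => //; rewrite ltr01 lexx.
have [|e /andP[e0 e1] sE] := IH.
  by move=> b bs; apply: s0; rewrite inE bs orbT.
have a0 : 0 <= a by apply: s0; rewrite mem_head.
have rle : e <= 1 - a \/ 1 - a < e.
  have ar : 1 - a \is Num.real by rewrite realB ?real1 // ger0_real.
  by have [|] := real_leP (gtr0_real e0) ar; [left|right].
case: rle => ea.
  exists e; first by rewrite e0.
  move=> b; rewrite inE => /predU1P[-> _|]; last exact: sE.
  by rewrite lerBrDr addrC -lerBrDr.
have [a1|a1] : a < 1 \/ ~ a < 1 by case: (a < 1); [left|right].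
  exists (1 - a); first by rewrite subr_gt0 a1 lerBlDr lerDl.
  move=> b; rewrite inE => /predU1P[-> _|bs b1]; first by rewrite subKr.
  by apply: (le_trans (sE _ bs b1)); rewrite lerD2l lerN2 ltW.
exists e; first by rewrite e0.
by move=> b; rewrite inE => /predU1P[->|]; [|exact: sE].
Qed.

End normed.

(** * A compact set containing the unit disc of scalars *)

Lemma normc_le_ReIm (R : rcfType) (z : R[i]) :
  `|z| <= (`|complex.Re z| + `|complex.Im z|)%:C%C.
Proof.
rewrite normc_def lecR -(ler_pXn2r (ltn0Sn 1)) ?nnegrE ?sqrtr_ge0 ?addr_ge0 //.
rewrite sqr_sqrtr ?addr_ge0 ?sqr_ge0 // sqrrD !real_normK ?num_real //.
by rewrite addrAC lerDl mulrn_wge0 // mulr_ge0.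
Qed.

(** For complex scalars [D] is the square with real and imaginary parts in [[-1, 1]], a continuous
    image of a product of two segments. *)
Lemma unit_disc_compact_cover (R : realType) (k : scalar_kind) :
  exists2 D : set (scalars R k)^o, compact D & [set a | `|a| <= 1] `<=` D.
Proof.
case: k => /=.
  exists `[-1, 1]%classic; first exact: segment_compact.
  by move=> a /=; rewrite ler_norml in_itv.
have cC : continuous
    (fun p : R * R => Complex p.1 p.2 : (R[i] : numFieldType)^o).
  move=> [a b]; apply/cvgrPdist_lt => e e0.
  (* A positive complex number is a positive real, so the estimate takes place in [R]. *)
  move: (e0); rewrite ltcE /= => /andP[/eqP e_im e_re].
  have e20 : 0 < complex.Re e / 2 by rewrite divr_gt0.
  near=> q.
  apply: le_lt_trans (normc_le_ReIm _) _; rewrite ltcE /= e_im eqxx /=.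
  rewrite [ltRHS]splitr; apply: ltrD.
    near: q; apply: (@cvgr_dist_lt _ _ _ _ _ fst a) => //; exact: cvg_fst.
  near: q; apply: (@cvgr_dist_lt _ _ _ _ _ snd b) => //; exact: cvg_snd.
exists [set Complex p.1 p.2 | p in `[-1, 1]%classic `*` `[-1, 1]%classic].
  apply: continuous_compact; first exact: continuous_subspaceT.
  by apply: compact_setX; exact: segment_compact.
move=> [a b] /=; rewrite normc_def lecR /= => ab1.
exists (a, b) => //; split; rewrite /= in_itv /= -ler_norml.
  by apply: le_trans ab1; rewrite -sqrtr_sqr ler_wsqrtr // lerDl sqr_ge0.
by apply: le_trans ab1; rewrite -sqrtr_sqr ler_wsqrtr // lerDr sqr_ge0.
Unshelve. all: by end_near. Qed.

(** * Adjoints of nonexpansive linear maps *)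

Section dual_comp.
Context (R : realType) (k : scalar_kind).
Local Notation K := (scalars R k).
Context (E F : normedModType K) (T : E -> F).
Hypotheses (linT : linear T) (T1 : forall x, `|T x| <= `|x|).

Lemma linear_nonexpansive_continuous : continuous T.
Proof.
apply: (lipschitz_continuous ltr01) => x y.
suff <- : T (x - y) = T x - T y by rewrite mul1r.
by rewrite addrC -scaleN1r linT scaleN1r addrC.
Qed.

Lemma dual_comp_subproof (f : dual F) : f \o T \in @dual_pred R k E.
Proof.
rewrite inE; split; first by move=> a x y /=; rewrite linT linearP.
move=> x; apply: continuous_comp; first exact: linear_nonexpansive_continuous.
exact: dual_continuous.
Qed.

Definition dual_comp (f : dual F) : dual E := Dual (dual_comp_subproof f).

Lemma dual_comp_norm f : `|dual_comp f| <= `|f|.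
Proof.
apply: dual_norm_le => [|x x1]; first exact: normr_ge0.
exact: (@dual_norm_ub1 _ _ _ f (T x) (le_trans (T1 x) x1)).
Qed.

Lemma dual_comp_continuous : continuous dual_comp.
Proof.
apply: (lipschitz_continuous ltr01) => f g.
have -> : dual_comp f - dual_comp g = dual_comp (f - g) by exact: dual_eq.
rewrite mul1r; exact: dual_comp_norm.
Qed.

End dual_comp.

(** * Evaluation functionals and closedness of state spaces *)

Section dual_facts.
Context (R : realType) (k : scalar_kind).
Local Notation K := (scalars R k).
Context (E : normedModType K).

Lemma dual_eval_continuous (x : E) : continuous (fun f : dual E => f x).
Proof.
apply: (@lipschitz_continuous K (dual E) K^o (`|x| + 1)) => [|f g].
  by rewrite ltr_wpDl.
have -> : (f x : K^o) - g x = (f - g) x by [].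
apply: le_trans (dual_norm_ub _ _) _.
by rewrite mulrC ler_wpM2r ?lerDl //; exact: dual_norm_ge0.
Qed.

Lemma state_space_closed (e : E) : closed (state_space e).
Proof.
apply: closedI.
  apply: (@preimage_closed _ _ (fun f : dual E => `|f|) [set 1]).
    by move=> f _; exact: norm_continuous.
  exact: (@normed_closed_set1 K K^o).
apply: (@preimage_closed _ _ (fun f : dual E => f e) [set 1]).
  by move=> f _; exact: dual_eval_continuous.
exact: (@normed_closed_set1 K K^o).
Qed.

Lemma dual_sum (I : Type) (s : seq I) (g : I -> dual E) x :
  (\sum_(i <- s) g i) x = \sum_(i <- s) g i x.
Proof. by elim/big_rec2: _ => // i y f _ <-. Qed.

End dual_facts.

(** * Embeddings and projections of the summands *)

Section c0_single.
Context (R : realType) (k : scalar_kind) (J : Type).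
Local Notation K := (scalars R k).
Context (X : J -> completeNormedModType K).
Implicit Types (i j : J) (x : c0_sum X).

(** [J] is a bare type, so [i = j] is decided classically, and [u] is transported along the equality
    to have type [X j]. *)
Definition single_fun i (u : X i) j : X j :=
  match pselect (i = j) with
  | left e => eq_rect i (fun l => X l : Type) u j e
  | right _ => 0
  end.

Lemma single_fun_id i u : @single_fun i u i = u.
Proof.
by rewrite /single_fun; case: pselect => // e;
   rewrite (Prop_irrelevance e erefl).
Qed.

Lemma single_fun_neq i u j : i <> j -> @single_fun i u j = 0.
Proof. by rewrite /single_fun; case: pselect. Qed.

Lemma single_vanishing i u : vanishing (@single_fun i u).
Proof.
move=> e e0; apply: (sub_finite_set _ (finite_set1 i)) => j /=.
have [ij _|ij] := pselect (i = j); first exact/esym.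
by rewrite single_fun_neq // normr0 lt_geF.
Qed.

Definition c0_single i (u : X i) : c0_sum X := C0Sum (single_vanishing u).

Lemma c0_single_linear i : linear (@c0_single i).
Proof.
move=> a u v; apply: c0_sum_eq => j; rewrite c0_sumD c0_sumZ /=.
have [e|ij] := pselect (i = j); first by case: j / e; rewrite !single_fun_id.
by rewrite !single_fun_neq // scaler0 addr0.
Qed.

Lemma c0_single_norm i (u : X i) : `|c0_single u| <= `|u|.
Proof.
apply: c0_norm_le => // j /=.
have [e|ij] := pselect (i = j); first by case: j / e; rewrite single_fun_id.
by rewrite single_fun_neq // normr0.
Qed.

Lemma c0_proj_linear i : linear (fun x : c0_sum X => x i).
Proof. by []. Qed.

Lemma c0_proj_norm i x : `|x i| <= `|x|.
Proof. exact: c0_norm_ub. Qed.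

(** [c0_pull] is the map [P_i] and [c0_restr] the map [R_i]: the adjoints of the projection and of
    the embedding. *)
Definition c0_pull i : dual (X i) -> dual (c0_sum X) :=
  dual_comp (@c0_proj_linear i) (@c0_proj_norm i).

Definition c0_restr i : dual (c0_sum X) -> dual (X i) :=
  dual_comp (@c0_single_linear i) (@c0_single_norm i).

Lemma c0_pullK i : cancel (@c0_pull i) (@c0_restr i).
Proof. by move=> f; apply: dual_eq => u; exact: (congr1 f (single_fun_id u)).
Qed.

End c0_single.

(** * Structure of the states at a point of norm one *)

Section c0_states.
Context (R : realType) (k : scalar_kind) (J : Type).
Local Notation K := (scalars R k).
Context (X : J -> completeNormedModType K) (x : c0_sum X).
Hypothesis x1 : `|x| = 1.

Lemma c0_coord_le1 i : `|x i| <= 1.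
Proof. by rewrite -x1 c0_proj_norm. Qed.

(** Only finitely many coordinates have norm at least 1/2, and [gap_below1] treats these. *)
Lemma c0_norm1_gap :
  exists2 e : K, 0 < e & forall i, `|x i| <> 1 -> `|x i| <= 1 - e.
Proof.
have h0 : 0 < 2^-1 :> K by rewrite invr_gt0.
have /(finite_image (fun i => `|x i|))/finite_seqP[s sE] := c0_vanishing x h0.
have [|e /andP[e0 e1] se] := @gap_below1 _ s.
  move=> a sa; have : [set` s] a by [].
  by rewrite -sE => -[i _ <-].
(* As [e <= 1], halving gives [1 - e / 2 >= 1 / 2], which covers the small coordinates too. *)
exists (e / 2) => [|i xi]; first exact: divr_gt0.
have [hi|hi] := real_leP (gtr0_real h0) (normr_real (x i)).
  apply: (@le_trans _ _ (1 - e)).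
    apply: se; last by rewrite lt_neqAle c0_coord_le1 andbT; exact/eqP.
    have : [set` s] `|x i| by rewrite -sE; exists i.
    by [].
  by rewrite lerD2l lerN2 ler_pdivrMr // ler_peMr ?ler1n // ltW.
apply: (le_trans (ltW hi)); rewrite lerBrDr.
by rewrite [leRHS]splitr div1r lerD2l ler_pdivrMr // mulVf ?pnatr_eq0.
Qed.

Lemma state_norm_le f (z : c0_sum X) :
  state_space x f -> (forall i, `|z i| <= 1) -> `|f z : K| <= 1.
Proof.
move=> [f1 _] z1.
have zn : `|z| <= 1 by exact: c0_norm_le.
by apply: le_trans (dual_norm_ub1 f zn) _; rewrite -dual_normE f1.
Qed.

(* [x + c t z] stays in the unit ball for [|t| <= 1] and small [c > 0], by the
   gap between [1] and the other coordinates of [x]. *)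
Lemma state_vanish f (z : c0_sum X) : state_space x f ->
  (forall i, `|x i| = 1 -> z i = 0) -> f z = 0.
Proof.
move=> fS z0; have [e e0 xe] := c0_norm1_gap.
have z1 : 0 < `|z| + 1 by rewrite ltr_wpDl.
(* The added 1 keeps the denominator positive, and [c] times any [|z i|] is at most [e]. *)
pose c := e / (`|z| + 1); have c0 : 0 < c by exact: divr_gt0.
have [t t1 tE] := norm_add_aligned 1 (c * f z).
have : `|f (x + (t * c) *: z) : K| <= 1.
  apply: (state_norm_le fS) => i; rewrite c0_sumD c0_sumZ.
  have [xi|xi] := pselect (`|x i| = 1); first by rewrite z0 // scaler0 addr0 xi.
  apply: le_trans (ler_normD _ _) _; rewrite -[leRHS](subrK e).
  apply: lerD; first exact: xe.
  rewrite normrZ normrM (gtr0_norm c0) -mulrA.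
  apply: (@le_trans _ _ (c * `|z i|)).
    by rewrite ler_piMl // mulr_ge0 // ltW.
  rewrite /c mulrAC ler_pdivrMr // ler_pM2l //.
  by apply: (le_trans (c0_proj_norm i z)); rewrite lerDl.
(* The bound now reads [1 + |c * f z| <= 1]. *)
rewrite linearD linearZ /= fS.2 /GRing.scale /= -mulrA tE normr1 gerDl.
by rewrite normr_le0 mulf_eq0 gt_eqF //= => /eqP.
Qed.

Lemma state_component_le f i u : state_space x f -> `|u| <= 1 ->
  `|1 - f (c0_single (x i))| + `|f (@c0_single _ _ _ X i u)| <= 1 :> K.
Proof.
move=> fS u1.
have [t t1 <-] :=
  norm_add_aligned (1 - f (c0_single (x i)) : K) (f (c0_single u)).
(* The argument of [f] on the right is [x] with its coordinate [i] replaced by [t *: u]. *)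
have -> : 1 - f (c0_single (x i)) + t * f (c0_single u) =
    f (x - c0_single (x i) + t *: c0_single u).
  by rewrite linearD linearB linearZ /= fS.2.
apply: (state_norm_le fS) => j; rewrite c0_sumD c0_sumZ c0_sumD /=.
have [e|ij] := pselect (i = j).
  case: j / e; rewrite !single_fun_id subrr add0r normrZ.
  exact: mulr_ile1.
rewrite !single_fun_neq // oppr0 scaler0 !addr0; exact: c0_coord_le1.
Qed.

Lemma state_component f i : state_space x f ->
  c0_restr i f = 0 \/
  exists a : K,
    exists2 g, `|a| <= 1 /\ state_space (x i) g & c0_restr i f = a *: g.
Proof.
move=> fS; set a : K := f (c0_single (x i)).
have le_a u : `|u| <= 1 -> `|1 - a| + `|c0_restr i f u : K| <= 1.
  exact: state_component_le.
have [a0|a0] := eqVneq a 0.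
  left; apply/eqP; rewrite -normr_le0.
  apply: dual_norm_le => // u /le_a.
  by rewrite a0 subr0 normr1 gerDl.
right; exists a, (a^-1 *: c0_restr i f);
  last by rewrite scalerA divff // scale1r.
have ax : (a^-1 *: c0_restr i f) (x i) = 1 by rewrite dualZ; exact: mulVf.
split.
  by apply: le_trans (le_a _ (c0_coord_le1 i)); rewrite lerDr.
split=> //; apply/eqP; rewrite eq_le; apply/andP; split.
  (* By [le_a], the values of [c0_restr i f] on the unit ball are at most [1 - |1 - a| <= |a|]. *)
  rewrite normrZ normfV ler_pdivrMl ?normr_gt0 // mulr1.
  apply: dual_norm_le => // u /le_a.
  rewrite addrC -lerBrDr => /le_trans; apply.
  by have := ler_normD (1 - a) a; rewrite subrK normr1 lerBlDr addrC.
(* The value 1 is attained at [x i], which lies in the unit ball. *)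
have := @dual_norm_ub1 _ _ _ (a^-1 *: c0_restr i f) (x i) (c0_coord_le1 i).
by rewrite ax normr1.
Qed.

(** The truncation [y] of [z] to the coordinates in [s] differs from [z] by an element on which [f]
    vanishes. Uniqueness in [s] ensures that each coordinate is counted once. *)
Lemma state_decomp f (s : seq {classic J}) : state_space x f -> uniq s ->
  [set i | `|x i| = 1] = [set` s] ->
  f = \sum_(i <- s) c0_pull (c0_restr i f).
Proof.
move=> fS us sE; apply: dual_eq => z; rewrite dual_sum.
pose y : c0_sum X := \sum_(i <- s) c0_single (z i).
have <- : f y = \sum_(i <- s) c0_pull (c0_restr i f) z by rewrite linear_sum.
apply/eqP; rewrite -subr_eq0 -linearB; apply/eqP.
apply: (state_vanish fS) => i xi.
have yE (r : seq {classic J}) : (\sum_(j <- r) c0_single (z j) : c0_sum X) i =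
    \sum_(j <- r) single_fun (z j) i by elim/big_rec2: _ => // j a b _ <-.
have si : (i : {classic J}) \in s.
  have : [set` s] i by rewrite -sE.
  by [].
rewrite c0_sumD -scaleN1r c0_sumZ scaleN1r yE (bigD1_seq (i : {classic J})) //=.
rewrite single_fun_id big1 ?addr0 ?subrr // => j ji.
by rewrite single_fun_neq // => e; rewrite e eqxx in ji.
Qed.

End c0_states.

Theorem corollary3p13 (R : realType) (k : scalar_kind) (J : Type)
    (X : J -> completeNormedModType (scalars R k)) (x : c0_sum X)
    (hx : `|x| = 1) :
  let Lambda : set J := [set i | `|x i| = 1] in
  compact (state_space x) <->
  (forall i : J, Lambda i -> compact (state_space (x i))).
Proof.
move=> Lambda; split=> [cS i xi|cS].
  have rc : continuous (@c0_restr _ _ _ X i) by exact: dual_comp_continuous.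
  have pc : continuous (@c0_pull _ _ _ X i) by exact: dual_comp_continuous.
  have prc : continuous (@c0_pull _ _ _ X i \o @c0_restr _ _ _ X i).
    by move=> f; apply: continuous_comp; [exact: rc | exact: pc].
  (* [F] is the range of [c0_pull]: the functionals that depend on coordinate [i] alone. *)
  pose F := [set f : dual (c0_sum X) | c0_pull (c0_restr i f) = f].
  have cF : closed F.
    exact: (@closed_fixed_points _ _
      (@c0_pull _ _ _ X i \o @c0_restr _ _ _ X i)).
  suff -> : state_space (x i) = c0_restr i @` (state_space x `&` F).
    apply: continuous_compact; first exact: continuous_subspaceT.
    exact: compact_closedI.
  apply/seteqP; split=> [f [f1 fx]|_ [f [[f1 fx] fF] <-]].
    exists (c0_pull f); last exact: c0_pullK.
    split; last by rewrite /F /= c0_pullK.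
    split=> //; apply/eqP; rewrite eq_le; apply/andP; split.
      by rewrite -f1; exact: dual_comp_norm.
    (* Since [f] is the restriction of its pullback, the pullback has norm at least 1. *)
    by rewrite -[leLHS]f1 -{1}(c0_pullK f); exact: dual_comp_norm.
  have rx : c0_restr i f (x i) = 1 by rewrite -fx -[in RHS]fF.
  split=> //; apply/eqP; rewrite eq_le; apply/andP; split.
    by rewrite -f1; exact: dual_comp_norm.
  by rewrite -[leLHS]f1 -{1}fF; exact: dual_comp_norm.
have [D cD D1] := unit_disc_compact_cover R k.
have finL : finite_set (Lambda : set {classic J}).
  apply: sub_finite_set (c0_vanishing x ltr01) => i /= ->; exact: lexx.
have [s0 s0E] := (finite_seqP _).1 finL.
pose s := undup s0; have us : uniq s by exact: undup_uniq.
have sE : Lambda = [set` s].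
  by rewrite s0E; apply/seteqP; split => i /=; rewrite mem_undup.
(* The two members of the union match the two cases of [state_component]. *)
pose A (i : {classic J}) : set (dual (c0_sum X)) :=
  @c0_pull _ _ _ X i @`
    ([set 0] `|` [set p.1 *: p.2 | p in D `*` state_space (x i)]).
have [i si|B [cB sB]] := @compact_sum_cover _ _ _ s A.
  apply: continuous_compact.
    by apply: continuous_subspaceT; exact: dual_comp_continuous.
  apply: compactU; first exact: compact_set1.
  apply: compact_scale => //; apply: cS.
  by have : [set` s] i by []; rewrite -sE.
apply: subclosed_compact cB _; first exact: state_space_closed.
move=> f fS; rewrite (state_decomp hx fS us sE); apply: sB => i si.
exists (c0_restr i f) => //.
have [->|[a [g [a1 gS] ->]]] := state_component hx i fS; first by left.
by right; exists (a, g) => //; split => //; exact: D1.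
Qed.
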